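(* Let $m,n,r$ be positive integers with $r\le\min(m,n)$. Let $Y_0=U_0S_0V_0^\top$ with $U_0\in\mathbb{R}^{m\times r}$, $V_0\in\mathbb{R}^{n\times r}$, $U_0^\top U_0=V_0^\top V_0=I_r$, and $S_0\in\mathbb{R}^{r\times r}$ invertible, and let $\Delta A\in\mathbb{R}^{m\times n}$ be an arbitrary prescribed increment. If $Y_1$ is the output of a $K$-$S$-$L$ step started from $(U_0,S_0,V_0)$ with increment $\Delta A$, then the reduced $K$-$L$ step started from $(U_0,S_0,V_0)$ with the same increment $\Delta A$ gives the same matrix $Y_1$.
   Context: $K$-$S$-$L$ step, started from $(U_0,S_0,V_0)$ with increment $\Delta A$: (1) set $K_1:=U_0S_0+\Delta A\,V_0$ and compute a factorization $U_1\widehat S_1=K_1$, where $U_1\in\mathbb{R}^{m\times r}$ has orthonormal columns and $\widehat S_1\in\mathbb{R}^{r\times r}$ is invertible; (2) set $\widetilde S_0:=\widehat S_1-U_1^\top\Delta A\,V_0$; (3) set $L_1:=V_0\widetilde S_0^\top+\Delta A^\top U_1$ and compute a factorization $V_1S_1^\top=L_1$, where $V_1\in\mathbb{R}^{n\times r}$ has orthonormal columns and $S_1\in\mathbb{R}^{r\times r}$ is invertible. The output is $Y_1:=U_1S_1V_1^\top$. Reduced $K$-$L$ step, started from $(U_0,S_0,V_0)$ with increment $\Delta A$: (1) set $K_1:=U_0S_0+\Delta A\,V_0=(Y_0+\Delta A)V_0$ and compute a factorization $U_1\widehat S_1=K_1$, where $U_1\in\mathbb{R}^{m\times r}$ has orthonormal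 columns; (2) set $L_1:=V_0S_0^\top U_0^\top U_1+\Delta A^\top U_1=(Y_0+\Delta A)^\top U_1$ and compute a factorization $V_1S_1^\top=L_1$, where $V_1\in\mathbb{R}^{n\times r}$ has orthonormal columns. The output is $Y_1:=U_1S_1V_1^\top$. *)

(* Defs.v *)
From mathcomp Require Import all_boot all_order all_algebra.
From mathcomp Require Import reals.

Set Implicit Arguments.
Unset Strict Implicit.
Unset Printing Implicit Defensive.

Import Order.TTheory GRing.Theory Num.Theory.

Local Open Scope ring_scope.

Definition orthonormal_cols (R : realType) (m r : nat) (U : 'M[R]_(m, r)) : Prop :=
  U^T *m U = 1%:M.

(* The factorizations K1 = U1 *m hS1 and L1 = V1 *m S1^T are not unique, so a
   step is a relation: it holds of every Y1 that results from some admissible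
   choice of the factors. *)

Definition KSL_step (R : realType) (m n r : nat)
    (U0 : 'M[R]_(m, r)) (S0 : 'M[R]_r) (V0 : 'M[R]_(n, r))
    (dA : 'M[R]_(m, n)) (Y1 : 'M[R]_(m, n)) : Prop :=
  exists (U1 : 'M[R]_(m, r)) (hS1 : 'M[R]_r)
         (V1 : 'M[R]_(n, r)) (S1 : 'M[R]_r),
    let K1 := U0 *m S0 + dA *m V0 in
    let tS0 := hS1 - U1^T *m dA *m V0 in
    let L1 := V0 *m tS0^T + dA^T *m U1 in
    [/\ [/\ U1 *m hS1 = K1, orthonormal_cols U1 & hS1 \in unitmx],
        [/\ V1 *m S1^T = L1, orthonormal_cols V1 & S1 \in unitmx]
      & Y1 = U1 *m S1 *m V1^T].

(* Unlike in KSL_step, the square factors are not required to be invertible. *)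
Definition reduced_KL_step (R : realType) (m n r : nat)
    (U0 : 'M[R]_(m, r)) (S0 : 'M[R]_r) (V0 : 'M[R]_(n, r))
    (dA : 'M[R]_(m, n)) (Y1 : 'M[R]_(m, n)) : Prop :=
  exists (U1 : 'M[R]_(m, r)) (hS1 : 'M[R]_r)
         (V1 : 'M[R]_(n, r)) (S1 : 'M[R]_r),
    let K1 := U0 *m S0 + dA *m V0 in
    let L1 := V0 *m S0^T *m U0^T *m U1 + dA^T *m U1 in
    [/\ U1 *m hS1 = K1 /\ orthonormal_cols U1,
        V1 *m S1^T = L1 /\ orthonormal_cols V1
      & Y1 = U1 *m S1 *m V1^T].

(* Main.v *)
Require Import Defs.
From mathcomp Require Import all_boot all_order all_algebra.
From mathcomp Require Import reals.

Import Order.TTheory GRing.Theory Num.Theory.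

Local Open Scope ring_scope.

(** The S-step only undoes the contribution of the increment to the factor of
    the K-step: multiplying [U1 *m hS1 = U0 *m S0 + dA *m V0] by [U1^T] gives
    [hS1 - U1^T *m dA *m V0 = U1^T *m U0 *m S0] ([S_step_factor]).  Hence both
    schemes factorize the same matrix [L1 = (Y0 + dA)^T *m U1], and the factors
    of a K-S-L step are also factors of a reduced K-L step.

    Since the factorizations are not unique, it remains to see that every
    choice gives the same output.  The output of a reduced step is
    [U1 *m L1^T = U1 *m U1^T *m (Y0 + dA)] ([KL_output]), so it depends on [U1]
    only through the projector [U1 *m U1^T].  Because some factorization of
    [K1] has an invertible square factor, [K1] has full column rank, and this
    projector is the orthogonal projector onto its range ([eq_projector]). *)

Lemma S_step_factor {R : realType} {m n r : nat} {U0 U1 : 'M[R]_(m, r)}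
    {S0 hS1 : 'M[R]_r} {V0 : 'M[R]_(n, r)} {dA : 'M[R]_(m, n)} :
  orthonormal_cols U1 -> U1 *m hS1 = U0 *m S0 + dA *m V0 ->
  hS1 - U1^T *m dA *m V0 = U1^T *m U0 *m S0.
Proof.
move=> oU1 /(congr1 (mulmx U1^T)).
by rewrite mulmxA oU1 mul1mx mulmxDr !mulmxA => ->; rewrite addrK.
Qed.

Lemma KL_output {R : realType} {m n r : nat} {U0 U1 : 'M[R]_(m, r)}
    {S0 S1 : 'M[R]_r} {V0 V1 : 'M[R]_(n, r)} {dA : 'M[R]_(m, n)} :
  V1 *m S1^T = V0 *m S0^T *m U0^T *m U1 + dA^T *m U1 ->
  U1 *m S1 *m V1^T = U1 *m U1^T *m (U0 *m S0 *m V0^T + dA).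
Proof.
move=> /(congr1 trmx); rewrite linearD /= !trmx_mul !trmxK => eL.
by rewrite -mulmxA eL !mulmxDr !mulmxA.
Qed.

(** The two orthonormal bases differ by [Q := B *m invmx A]; orthonormality of
    both makes [Q^T *m Q = 1%:M], and [Q *m Q^T = 1%:M] follows as [Q] is square,
    so that [Q] cancels in [U *m U^T]. *)
Lemma eq_projector {R : realType} {m r : nat} {U V : 'M[R]_(m, r)}
    {A B : 'M[R]_r} :
  orthonormal_cols U -> orthonormal_cols V -> A \in unitmx ->
  U *m A = V *m B -> U *m U^T = V *m V^T.
Proof.
move=> oU oV uA eUV; pose Q := B *m invmx A.
have defU : U = V *m Q by rewrite mulmxA -eUV mulmxK.
have QtQ : Q^T *m Q = 1%:M.
  by move: oU; rewrite /orthonormal_cols defU trmx_mul mulmxA -(mulmxA Q^T) oV mulmx1.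
by rewrite defU trmx_mul mulmxA -(mulmxA V) (mulmx1C QtQ) mulmx1.
Qed.

Theorem mainTheorem1 (R : realType) (m n r : nat)
    (hm : (0 < m)%N) (hn : (0 < n)%N) (hr : (0 < r)%N) (hrmn : (r <= minn m n)%N)
    (Y0 : 'M[R]_(m, n)) (U0 : 'M[R]_(m, r)) (S0 : 'M[R]_r) (V0 : 'M[R]_(n, r))
    (hY0 : Y0 = U0 *m S0 *m V0^T)
    (hU0 : orthonormal_cols U0) (hV0 : orthonormal_cols V0)
    (hS0 : S0 \in unitmx)
    (dA : 'M[R]_(m, n)) (Y1 : 'M[R]_(m, n)) :
  KSL_step U0 S0 V0 dA Y1 ->
  reduced_KL_step U0 S0 V0 dA Y1 /\
  (forall Y : 'M[R]_(m, n), reduced_KL_step U0 S0 V0 dA Y -> Y = Y1).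
Proof.
move=> [U1 [hS1 [V1 [S1 /= [[eK oU1 uhS1] [eL oV1 _] ->]]]]].
rewrite (S_step_factor oU1 eK) !trmx_mul trmxK !mulmxA in eL.
split; first by exists U1, hS1, V1, S1.
move=> _ [U2 [hS2 [V2 [S2 /= [[eK2 oU2] [eL2 _] ->]]]]].
rewrite (KL_output eL) (KL_output eL2).
by rewrite (eq_projector oU1 oU2 uhS1 (etrans eK (esym eK2))).
Qed.
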